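(* Consider $N$ contents, where content $i$ has storage cost per unit of time $c_i$ and miss cost $m_i$, and suppose the sequence of future requests is known. Let TTL-OPT be the clairvoyant policy that, at each request (occurring at time $t_{\mathrm{now}}$, for content $j$, whose next request occurs at time $t_{j,\mathrm{next}}$), sets the timer of content $j$ to $$T_j=\begin{cases} t_{j,\mathrm{next}}-t_{\mathrm{now}} & \text{if } c_j\,(t_{j,\mathrm{next}}-t_{\mathrm{now}})<m_j \quad(\text{store } j \text{ until its next request}),\\ 0 & \text{otherwise}\quad(\text{serve } j \text{ but do not store it}).\end{cases}$$ Then TTL-OPT minimizes, among TTL policies, the sum of storage and miss costs, i.e. the total cost $$C(0,t)=\sum_{i=1}^N\left(\int_0^t X_i(s)\,c_i\,ds+M_i(t)\,m_i\right),$$ where $X_i(s)$ is the indicator that content $i$ is stored in the cache at time $s$ and $M_i(t)$ is the number of misses for content $i$ in $[0,t]$.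
   Context: TTL policy (with renewal): upon each request for a content, the content is served and its timer is set (or, on a hit, reset) to a chosen value; the content remains in the cache until its timer expires, and is then evicted. The timer value may be different for each content and for each request, and a clairvoyant policy may choose it using the knowledge of all future requests. A timer value of $0$ means that the content is not stored; a timer equal to the time until the next request for that content means that it is stored until that request, which is then a hit. A request for a content not in the cache is a miss; the first request for each content is always a miss. There is no constraint on the cache capacity. Content $i$ costs $c_i$ per unit of time while it is stored, and each miss for content $i$ costs $m_i$; the total cost paid during $[0,t]$ is the sum over all contents of these storage and miss costs. For each content $i$ the request times form a sequence $\{t_{i,k},\,k\in\mathbb N\}$.
   Formalization: At a fixed t the claim can fail (storage paid before t, hit after t), so optimality of C(0,t) is proved when no TTL-OPT timer set before t runs past t, and for every t with timer 0 if the next request is after t; for any t TTL-OPT is within the sum of the m_i of every policy. *)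

(* Defs.v *)
From HB Require Import structures.
From mathcomp Require Import all_boot all_order all_algebra.
From mathcomp Require Import all_classical all_reals all_analysis.

Set Implicit Arguments.
Unset Strict Implicit.
Unset Printing Implicit Defensive.

Import Order.TTheory GRing.Theory Num.Theory.
Import numFieldNormedType.Exports.

Local Open Scope classical_set_scope.
Local Open Scope ring_scope.

Section OneContent.
Context {R : realType}.
Implicit Types (t T : nat -> R) (c m h : R).

(* The last clause says that a bounded time window contains finitely many
   requests. *)
Definition is_request_sequence t : Prop :=
  [/\ 0 <= t 0%N, forall k, t k < t k.+1 & forall h, exists k, h < t k].

(* The times at which the content is stored when the timer is set to [T k] by
   the k-th request, each request discarding the previous timer.  The set is
   left-continuous in time: at [s = t k] it tells whether the content is in the
   cache when the k-th request arrives (before the timer is renewed), so that a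
   timer equal to the time until the next request yields a hit, a timer equal
   to 0 never stores anything, and the cache is empty until the first
   request. *)
Definition stored t T : set R :=
  [set s | exists k, [/\ t k < s, s <= t k.+1 & s <= t k + T k]].

Definition misses t T h : set nat :=
  [set k | t k <= h /\ ~ stored t T (t k)].

Definition content_cost c m t T h : \bar R :=
  (\int[lebesgue_measure]_(s in `[0%R, h]) (\1_(stored t T) s * c)%:E
   + counting (misses t T h) * m%:E)%E.

End OneContent.

Section TTLPolicies.
Context {R : realType} {N : nat}.
Implicit Types (t T : 'I_N -> nat -> R) (c m : 'I_N -> R) (h : R).

(* For a known request sequence [t], a (clairvoyant) TTL policy is a choice of
   a timer [T i k] for the k-th request of each content i; since all these
   choices may depend on [t], they are arbitrary nonnegative numbers. *)
Definition is_ttl_policy T : Prop := forall i k, 0 <= T i k.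

(* C(0, h) *)
Definition total_cost c m t T h : \bar R :=
  (\sum_(i < N) content_cost (c i) (m i) (t i) (T i) h)%E.

Definition ttl_opt c m t : 'I_N -> nat -> R := fun i k =>
  if c i * (t i k.+1 - t i k) < m i then t i k.+1 - t i k else 0.

(* TTL-OPT for the requests that occur in [0, h] only: the last request of each
   content in this window has no next request, hence nothing is stored. *)
Definition ttl_opt_window c m t h : 'I_N -> nat -> R := fun i k =>
  if t i k.+1 <= h then ttl_opt c m t i k else 0.

Definition minimizes_cost c m t h T : Prop :=
  is_ttl_policy T /\
  forall T', is_ttl_policy T' ->
    (total_cost c m t T h <= total_cost c m t T' h)%E.

(* No timer set before time h is still running after time h. *)
Definition timers_expired t T h : Prop :=
  forall i k, t i k < h -> t i k + T i k <= h.

End TTLPolicies.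

(* Main.v *)
(* The requests of a content in [0, h] cut its cost into the unavoidable first
   miss and one term for each request k, covering the storage until the next
   request and the miss of that next request.  This term depends on the policy
   only through the k-th timer, so each timer can be optimized separately:
   storing until the next request costs c (t_{k+1} - t_k), not doing so costs at
   least the miss m, and TTL-OPT takes the minimum of the two.  Only the last
   request in [0, h] escapes this comparison, since its next request is a hit or
   a miss after h; there TTL-OPT pays at most m, for storage. *)

Require Import Defs.
From HB Require Import structures.
From mathcomp Require Import all_boot all_order all_algebra.
From mathcomp Require Import all_classical all_reals all_analysis.
From mathcomp Require Import measurable_realfun.

Set Implicit Arguments.
Unset Strict Implicit.
Unset Printing Implicit Defensive.

Import Order.TTheory GRing.Theory Num.Theory.
Import numFieldNormedType.Exports.

Local Open Scope classical_set_scope.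
Local Open Scope ring_scope.

(** Makes the number of misses a sum over requests, to be merged term by term with the storage
    cost. *)
Lemma counting_sub_II (R : realType) (A : set nat) (n : nat) :
  A `<=` `I_n -> counting A = (\sum_(k < n) (nat_of_ord k \in A)%:R)%:E :> \bar R.
Proof.
move=> An.
have -> : counting A =
    counting (\big[setU/set0]_(k < n) (A `&` [set nat_of_ord k])) :> \bar R.
  congr counting.
  rewrite -(bigcup_mkord n (fun k => A `&` [set k])) -setI_bigcupr.
  apply/seteqP; split=> [k Ak|k []//].
  by split=> //; exists k => //; exact: An.
rewrite (measure_bigsetU (@counting nat R) (F := fun k => A `&` [set k])) //.
- rewrite -sumEFin; apply: eq_bigr => -[k /= _] _.
  rewrite setI1; case: ifP => _.
    by rewrite /= /counting asboolT// fset_set1 finmap.cardfs1.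
  by rewrite /= /counting asboolT// fset_set0.
- by move=> i j _ _ [k [[_ ->] [_ ->]]].
Qed.

(** * Request times *)

Section RequestSequence.
Context {R : realType}.
Implicit Types (t T : nat -> R) (c m h x : R).

Lemma request_lt t j k : is_request_sequence t -> (j < k)%N -> t j < t k.
Proof.
case=> _ t_incr _; apply: (homo_ltn (r := fun x y => x < y)) => //.
exact: lt_trans.
Qed.

Lemma request_le t j k : is_request_sequence t -> (j <= k)%N -> t j <= t k.
Proof.
move=> tP; rewrite leq_eqVlt => /predU1P[->//|jk].
by apply: ltW; exact: request_lt.
Qed.

Lemma request_ge0 t k : is_request_sequence t -> 0 <= t k.
Proof.
by move=> tP; case: (tP) => t0 _ _; apply: le_trans t0 _; exact: request_le.
Qed.

Lemma request_window t h : is_request_sequence t ->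
  exists n, forall k, (t k <= h) = (k < n)%N.
Proof.
move=> tP; case: (tP) => _ _ t_unbounded.
(* [n] is the least index of a request after [h], hence the number of requests up to [h]. *)
have [n hn n_min] := ex_minnP (t_unbounded h).
exists n => k; apply/idP/idP => [kh|kn].
  rewrite ltnNge; apply/negP => nk.
  by have := lt_le_trans hn (request_le tP nk); rewrite ltNge kh.
by rewrite leNgt; apply/negP => /n_min; rewrite leqNgt kn.
Qed.

Lemma stored_request0 t T : is_request_sequence t -> ~ stored t T (t 0%N).
Proof.
by move=> tP [k [+ _ _]]; apply/negP; rewrite -leNgt; exact: request_le.
Qed.

(** The only request time in []t j, t j.+1]] is [t j.+1], so the [k]-th timer alone decides whether
    the next request is a hit. *)
Lemma stored_requestS t T k : is_request_sequence t ->
  stored t T (t k.+1) <-> t k.+1 <= t k + T k.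
Proof.
move=> tP; split=> [[j [jk kj]]|kT].
  suff -> : j = k by [].
  apply/eqP; rewrite eqn_leq; apply/andP; split; rewrite leqNgt; apply/negP.
    by move=> /(request_le tP); rewrite leNgt jk.
  by rewrite -ltnS => /(request_lt tP); rewrite ltNge kj.
by exists k; split=> //; exact: request_lt.
Qed.

(** * Storage time within [[0, h]] *)

Lemma storedE t T :
  stored t T = \bigcup_k `]t k, Num.min (t k.+1) (t k + T k)]%classic.
Proof.
apply/seteqP; split=> s.
  by move=> [k [ks sk sT]]; exists k => //=; rewrite in_itv/= ks le_min sk sT.
by move=> [k _] /=; rewrite in_itv/= le_min => /and3P[? ? ?]; exists k.
Qed.

Lemma measurable_stored t T : measurable (stored t T).
Proof. by rewrite storedE; exact: bigcupT_measurable. Qed.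

Definition storage_end t h k x : R :=
  Num.min (Num.min (t k.+1) (t k + x)) h.

Lemma stored_window t T h n : is_request_sequence t ->
  (forall k, (t k <= h) = (k < n)%N) ->
  stored t T `&` `[0, h]%classic =
  \big[setU/set0]_(k < n) `]t k, storage_end t h k (T k)]%classic.
Proof.
move=> tP tn.
rewrite -(bigcup_mkord n (fun k => `]t k, storage_end t h k (T k)]%classic)).
apply/seteqP; split=> s.
  move=> [[k [ks sk sT]]] /=; rewrite in_itv/= => /andP[_ sh].
  exists k; first by rewrite /= -tn; apply: le_trans (ltW ks) sh.
  by rewrite /= in_itv/= ks !le_min sk sT sh.
move=> [k _] /=; rewrite in_itv/= !le_min => /andP[ks /andP[/andP[sk sT] sh]].
split; first by exists k.
by rewrite /= in_itv/= sh andbT (le_trans (request_ge0 k tP))// ltW.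
Qed.

Lemma lebesgue_measure_stored t T h n : is_request_sequence t ->
  (forall k, 0 <= T k) -> (forall k, (t k <= h) = (k < n)%N) ->
  lebesgue_measure (stored t T `&` `[0, h]%classic) =
  (\sum_(k < n) (storage_end t h k (T k) - t k))%:E.
Proof.
move=> tP T0 tn; rewrite (stored_window _ tP tn).
rewrite (measure_bigsetU lebesgue_measure
  (F := fun k => `]t k, storage_end t h k (T k)]%classic)) //.
  rewrite -sumEFin; apply: eq_bigr => -[k /= kn] _.
  rewrite lebesgue_measure_itv/= lte_fin.
  (* An empty interval must end exactly at [t k], because the timer is nonnegative and [t k <= h];
     the difference of endpoints is then its length 0. *)
  case: ltP => // le_end.
  suff -> : storage_end t h k (T k) = t k by rewrite subrr.
  apply/le_anti; rewrite le_end !le_min tn kn lerDl T0 !andbT.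
  exact: request_le.
apply: ltn_trivIset => j k kj; rewrite -subset0 => s [] /=.
rewrite !in_itv/= !le_min => /andP[_ /andP[/andP[sk _] _]] /andP[js _].
by move: (le_lt_trans (request_le tP kj) js); rewrite ltNge sk.
Qed.

(** * Decomposition of the cost by request *)

Definition request_cost c m t h k x : R :=
  (storage_end t h k x - t k) * c +
  ((t k.+1 <= h) && (t k + x < t k.+1))%:R * m.

Lemma counting_misses t T h n : is_request_sequence t ->
  (forall k, (t k <= h) = (k < n)%N) ->
  counting (misses t T h) =
  ((0 < n)%N%:R +
   \sum_(k < n) ((t k.+1 <= h) && (t k + T k < t k.+1))%:R)%:E :> \bar R.
Proof.
move=> tP tn; rewrite (@counting_sub_II R _ n); last first.
  by move=> k [+ _]; rewrite tn.
congr EFin; case: n tn => [|n] tn; first by rewrite !big_ord0 addr0.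
(* The indices are shifted by one: the miss of request 0 is split off on the left, and on the right
   the last term vanishes since [t n.+1] lies after [h]. *)
rewrite big_ord_recl big_ord_recr/= tn ltnn addr0; congr (_ + _).
  rewrite mem_set// /misses/=; split; first by rewrite tn.
  exact: stored_request0.
apply: eq_bigr => -[k /= kn] _; congr (_%:R); congr nat_of_bool.
apply/idP/idP => [/set_mem[-> /(contra_not (stored_requestS _ _ tP).2)]|].
  by move/negP; rewrite -ltNge.
move=> /andP[kh]; rewrite ltNge => /negP Tk; apply/mem_set; split=> //.
by move/(stored_requestS _ _ tP).
Qed.

Lemma content_costE c m t T h n : 0 <= c -> is_request_sequence t ->
  (forall k, 0 <= T k) -> (forall k, (t k <= h) = (k < n)%N) ->
  content_cost c m t T h =
  ((0 < n)%N%:R * m + \sum_(k < n) request_cost c m t h k (T k))%:E.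
Proof.
move=> c0 tP T0 tn; rewrite /content_cost (counting_misses _ tP tn).
under eq_integral do rewrite EFinM.
rewrite ge0_integralZr ?lee_fin//; last first.
  by apply/measurable_EFinP; apply: measurable_indic; exact: measurable_stored.
rewrite integral_indic//; last exact: measurable_stored.
rewrite [X in (X * _)%E](lebesgue_measure_stored tP T0 tn) -!EFinM -EFinD.
congr EFin.
by rewrite [in RHS]big_split/= [in LHS]mulrDl !mulr_suml addrCA.
Qed.

Lemma le_content_cost c m t T T' h : 0 <= c -> is_request_sequence t ->
  (forall k, 0 <= T k) -> (forall k, 0 <= T' k) ->
  (forall k, t k <= h ->
    request_cost c m t h k (T k) <= request_cost c m t h k (T' k)) ->
  (content_cost c m t T h <= content_cost c m t T' h)%E.
Proof.
move=> c0 tP T0 T'0 le_TT'; have [n tn] := request_window h tP.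
rewrite !(content_costE m c0 tP _ tn)// lee_fin lerD2l.
by apply: ler_sum => k _; apply: le_TT'; rewrite tn.
Qed.

(** * Comparison of timers for one request *)

Lemma request_cost_ge0 c m t h k x : 0 <= c -> 0 <= m ->
  is_request_sequence t -> t k <= h -> 0 <= x -> 0 <= request_cost c m t h k x.
Proof.
move=> c0 m0 tP kh x0; rewrite addr_ge0 ?mulr_ge0 ?ler0n//.
by rewrite subr_ge0 !le_min kh lerDl x0 request_le.
Qed.

Lemma request_cost_long c m t h k x : t k.+1 <= h -> t k.+1 - t k <= x ->
  request_cost c m t h k x = (t k.+1 - t k) * c.
Proof.
rewrite lerBlDl => kh kx.
by rewrite /request_cost /storage_end (min_l kx) (min_l kh) ltNge kx andbF
  mul0r addr0.
Qed.

Lemma request_cost_short c m t h k x : 0 <= c -> is_request_sequence t ->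
  t k.+1 <= h -> 0 <= x -> x < t k.+1 - t k -> m <= request_cost c m t h k x.
Proof.
rewrite ltrBrDl => c0 tP kh x0 xk; rewrite /request_cost kh xk mul1r lerDr.
rewrite mulr_ge0// subr_ge0 !le_min lerDl x0 request_le//=.
exact: le_trans (request_le tP (leqnSn k)) kh.
Qed.

Lemma request_cost0 c m t h k : is_request_sequence t -> t k <= h ->
  request_cost c m t h k 0 = (t k.+1 <= h)%R%:R * m.
Proof.
move=> tP kh; have ltk := request_lt tP (ltnSn k).
rewrite /request_cost /storage_end addr0 ltk andbT (min_r (ltW ltk)).
by rewrite (min_l kh) subrr mul0r add0r.
Qed.

(** One-content form of [ttl_opt], convertible to it. *)
Definition opt_timer c m t k : R :=
  if c * (t k.+1 - t k) < m then t k.+1 - t k else 0.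

Lemma opt_timer_ge0 c m t k : is_request_sequence t -> 0 <= opt_timer c m t k.
Proof.
by move=> tP; rewrite /opt_timer; case: ifP; rewrite // subr_ge0 request_le.
Qed.

Lemma request_cost_opt_min c m t h k x : 0 <= c -> is_request_sequence t ->
  t k.+1 <= h -> 0 <= x ->
  request_cost c m t h k (opt_timer c m t k) <= request_cost c m t h k x.
Proof.
move=> c0 tP kh x0.
have kh' : t k <= h := le_trans (request_le tP (leqnSn k)) kh.
rewrite /opt_timer; case: ltP => gapm; rewrite mulrC in gapm.
  rewrite request_cost_long//; case: (leP (t k.+1 - t k) x) => kx.
    by rewrite request_cost_long.
  exact: le_trans (ltW gapm) (request_cost_short m c0 tP kh x0 kx).
rewrite request_cost0// kh mul1r; case: (leP (t k.+1 - t k) x) => kx.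
  by rewrite request_cost_long.
exact: request_cost_short.
Qed.

Lemma request_cost_opt_last c m t h k : 0 <= c -> 0 <= m ->
  is_request_sequence t -> t k <= h -> h < t k.+1 ->
  request_cost c m t h k (opt_timer c m t k) <= m.
Proof.
move=> c0 m0 tP kh hk; rewrite /opt_timer; case: ltP => gapm.
  rewrite /request_cost (leNgt _ h) hk mul0r addr0 mulrC.
  (* Storage cut off at [h] costs at most storage over the whole gap, which the rule keeps below
     [m]. *)
  apply: le_trans (ltW gapm); apply: ler_wpM2l => //.
  by rewrite lerD2r !ge_min lexx.
by rewrite request_cost0// (leNgt _ h) hk mul0r.
Qed.

Lemma content_cost_opt_le c m t T h : 0 <= c -> 0 <= m ->
  is_request_sequence t -> (forall k, 0 <= T k) ->
  (content_cost c m t (opt_timer c m t) h <= content_cost c m t T h + m%:E)%E.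
Proof.
move=> c0 m0 tP T0; have [n tn] := request_window h tP.
have opt0 k := opt_timer_ge0 c m k tP.
rewrite !(content_costE m c0 tP _ tn)// -EFinD lee_fin -addrA lerD2l.
case: n tn => [|n] tn; first by rewrite !big_ord0 add0r.
rewrite !big_ord_recr/= -addrA lerD//.
  apply: ler_sum => k _; apply: request_cost_opt_min => //.
  by rewrite tn ltnS.
have nh : t n <= h by rewrite tn.
apply: (le_trans (y := m)); last by rewrite lerDr request_cost_ge0.
by apply: request_cost_opt_last => //; rewrite ltNge tn ltnn.
Qed.

End RequestSequence.

(* An infinite request sequence always has a request after the horizon h, and a
   policy that stores a content across h pays for that storage in [0, h] while
   the hit falls outside.  Hence optimality of C(0, h) is stated (1) for every h
   that does not interrupt a storage period of TTL-OPT and (2) for every h when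
   the future requests are those in [0, h]; (3) for an arbitrary h, TTL-OPT is
   within one miss per content of every policy, so it also minimizes the
   long-run cost per unit of time. *)
Theorem proposition2 (R : realType) (N : nat)
    (c m : 'I_N -> R) (t : 'I_N -> nat -> R)
    (c_ge0 : forall i, 0 <= c i) (m_ge0 : forall i, 0 <= m i)
    (t_req : forall i, is_request_sequence (t i)) :
  [/\ forall h : R, 0 <= h -> timers_expired t (ttl_opt c m t) h ->
        minimizes_cost c m t h (ttl_opt c m t),
      forall h : R, 0 <= h ->
        minimizes_cost c m t h (ttl_opt_window c m t h) &
      forall (h : R) (T : 'I_N -> nat -> R), 0 <= h -> is_ttl_policy T ->
        (total_cost c m t (ttl_opt c m t) h <=
         total_cost c m t T h + (\sum_(i < N) m i)%:E)%E].
Proof.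
have opt0 : is_ttl_policy (ttl_opt c m t) by move=> i k; exact: opt_timer_ge0.
split.
- move=> h _ expired; split=> // T' T'0; apply: lee_sum => i _.
  apply: le_content_cost => // k kh; have [Skh|hSk] := leP (t i k.+1) h.
    exact: request_cost_opt_min.
  suff -> : request_cost (c i) (m i) (t i) h k (ttl_opt c m t i k) = 0.
    exact: request_cost_ge0.
  have [stops|] := leP (t i k + ttl_opt c m t i k) h; last first.
    (* A timer still running after [h] can only have been set at [h] itself, so it stores nothing
       inside the window. *)
    move=> runs; have kE : t i k = h.
      apply/eqP; rewrite eq_le kh leNgt; apply/negP => /expired.
      by rewrite leNgt runs.
    rewrite /request_cost /storage_end min_r; last by rewrite le_min !ltW.
    by rewrite kE subrr (leNgt _ h) hSk !mul0r addr0.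
  (* A timer over by [h] cannot be the full gap, which reaches past [h]. *)
  have -> : ttl_opt c m t i k = 0.
    move: stops; rewrite /ttl_opt; case: ifP => // _.
    by rewrite addrC subrK leNgt hSk.
  by rewrite request_cost0// (leNgt _ h) hSk mul0r.
- move=> h _; have window0 : is_ttl_policy (ttl_opt_window c m t h).
    by move=> i k; rewrite /ttl_opt_window; case: ifP => // _; exact: opt0.
  split=> // T' T'0; apply: lee_sum => i _.
  apply: le_content_cost => // k kh.
  rewrite /ttl_opt_window; have [Skh|hSk] := leP (t i k.+1) h.
    exact: request_cost_opt_min.
  by rewrite request_cost0// (leNgt _ h) hSk mul0r; exact: request_cost_ge0.
- move=> h T _ T0; rewrite -sumEFin -big_split/=.
  by apply: lee_sum => i _; exact: content_cost_opt_le.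
Qed.
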